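(* Let $F$ be an ordered forest on $n$ vertices and let $a,b\geq 1$ be integers. Then $R_<(F,K_{a,b})\leq 1+(n-1)(a+b-1)$.
   Context: All graphs are finite and simple, with at least one vertex. An ordered graph is a graph equipped with a linear order on its vertex set; an ordered forest is an ordered graph whose underlying graph is a forest (acyclic). A copy of an ordered graph $G$ in an ordered graph $G'$ is a (not necessarily induced) subgraph of $G'$ isomorphic to $G$ via an order-preserving isomorphism. For ordered graphs $G,H$, the ordered Ramsey number $R_<(G,H)$ is the minimum $N$ such that every red/blue coloring of the edges of the complete graph $K_N$ with linearly ordered vertex set contains a red copy of $G$ or a blue copy of $H$ (as ordered graphs). $K_{a,b}$ denotes the ordered complete bipartite graph with parts of sizes $a$ and $b$ in which all vertices of the part with $a$ vertices come before all vertices of the part with $b$ vertices in the vertex ordering. *)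

(* Defs.v *)
From HB Require Import structures.
From mathcomp Require Import all_boot all_order.

Set Implicit Arguments.
Unset Strict Implicit.
Unset Printing Implicit Defensive.

Import Order.TTheory.

Record ordered_graph := OrderedGraph {
  odisp : Order.disp_t;
  vertex :> finOrderType odisp;
  edge : rel vertex;
  edge_sym : symmetric edge;
  edge_irr : irreflexive edge
}.

Arguments edge : clear implicits.

(* [ucycle] also accepts [:: x; y] for an edge xy, whence the bound 2. *)
Definition acyclic (G : ordered_graph) : Prop :=
  forall s : seq G, ucycle (edge G) s -> size s <= 2.

Definition subgraph (G : ordered_graph) (W : {set G}) (D : rel G) : Prop :=
  symmetric D /\
  (forall x y : G, D x y -> [/\ x \in W, y \in W & edge G x y]).

Definition order_iso (G G' : ordered_graph) (W : {set G'}) (D : rel G')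
    (f : G -> G') : Prop :=
  [/\ {mono f : x y / (x <= y)%O},
      f @: [set: G] = W
    & forall x y : G, D (f x) (f y) = edge G x y].

Definition contains_copy (G' G : ordered_graph) : Prop :=
  exists (W : {set G'}) (D : rel G') (f : G -> G'),
    subgraph W D /\ order_iso W D f.

(* A colouring of the edges of K_N is a map on all sets of vertices, of which
   only the values on pairs matter; [true] is red and [false] is blue. *)
Definition colour_edge (N : nat) (c : {set 'I_N} -> bool) (col : bool) :
    rel 'I_N :=
  fun x y => (x != y) && (c [set x; y] == col).

Lemma colour_edge_sym N (c : {set 'I_N} -> bool) col :
  symmetric (colour_edge c col).
Proof. by move=> x y; rewrite /colour_edge eq_sym setUC. Qed.

Lemma colour_edge_irr N (c : {set 'I_N} -> bool) col :
  irreflexive (colour_edge c col).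
Proof. by move=> x; rewrite /colour_edge eqxx. Qed.

Definition colour_class (N : nat) (c : {set 'I_N} -> bool) (col : bool) :
    ordered_graph :=
  OrderedGraph (colour_edge_sym c col) (colour_edge_irr c col).

Definition arrows (N : nat) (G H : ordered_graph) : Prop :=
  forall c : {set 'I_N} -> bool,
    contains_copy (colour_class c true) G \/
    contains_copy (colour_class c false) H.

Definition is_ordered_ramsey_number (G H : ordered_graph) (R : nat) : Prop :=
  arrows R G H /\ (forall N : nat, arrows N G H -> R <= N).

Definition Kab_edge (a b : nat) : rel 'I_(a + b) :=
  fun x y => (x < a) != (y < a).
Arguments Kab_edge : clear implicits.

Lemma Kab_edge_sym a b : symmetric (Kab_edge a b).
Proof. by move=> x y; rewrite /Kab_edge eq_sym. Qed.

Lemma Kab_edge_irr a b : irreflexive (Kab_edge a b).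
Proof. by move=> x; rewrite /Kab_edge eqxx. Qed.

Definition Kab (a b : nat) : ordered_graph :=
  OrderedGraph (@Kab_edge_sym a b) (@Kab_edge_irr a b).

(* Main.v *)
Require Import Defs.
From HB Require Import structures.
From mathcomp Require Import all_boot all_order.
From mathcomp Require Import zify.
From Stdlib Require Import Classical.

(** Write [N = 1 + (n - 1) * (a + b - 1)] and suppose that a colouring of K_N
    has no blue K_{a,b}.  Then, between a set A and a set B of later vertices,
    there is a red edge as soon as [a <= #|A|] and [b <= #|B|].

    Cut the N vertices into consecutive intervals [V u], one for each vertex u
    of the forest F and in the order of F, where [V u] has
      1 + (a - 1) * (number of neighbours after u)
        + (b - 1) * (number of neighbours before u)
    elements.  An edge of F contributes [a - 1] to the interval of its left end
    and [b - 1] to that of its right end, and F has at most [n - 1] edges, so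
    the intervals take up at most [n + (n - 1) * (a + b - 2) = N] places
    ([forest_weight], [consecutive_intervals]).

    Now each u can be sent to a point of [V u] so that the edges of F become
    red ([forest_embedding]).  Take a leaf v of F, with neighbour u, say
    [u < v].  The points of [V u] without a red neighbour in [V v] are at most
    [a - 1], since [V v] has at least b points.  Delete them from [V u] and v
    from F: u has lost one later neighbour, so its interval is still as large
    as required.  Embed the smaller forest, then choose the image of v among
    the red neighbours of the image of u.  As the intervals are consecutive,
    the embedding preserves the order. *)

Set Implicit Arguments.
Unset Strict Implicit.
Unset Printing Implicit Defensive.

Import Order.TTheory.

(** * Removing leaves from a forest *)

(** If every vertex of S had two neighbours in S, a path in S could always be
    prolonged at its head x, by a neighbour of x other than the next vertex of
    the path: were that neighbour on the path, it would close a cycle. *)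
Lemma acyclic_leaf (G : ordered_graph) (S : {set G}) :
  acyclic G -> S != set0 ->
  exists2 v, v \in S &
    forall u w, u \in S -> w \in S -> edge G v u -> edge G v w -> u = w.
Proof.
move=> hG /set0Pn[x0 x0S].
case: (pickP [pred v | (v \in S) &&
  [forall u in S, forall w in S, edge G v u ==> edge G v w ==> (u == w)]]).
  move=> v /= /andP[vS /forall_inP hv]; exists v => // u w uS wS vu vw.
  by have /forall_inP/(_ _ wS) := hv u uS; rewrite vu vw => /eqP.
move=> nolow.
have two v z : v \in S -> exists2 u, u \in S & edge G v u /\ u != z.
  move=> vS; have /= := nolow v; rewrite vS /=.
  move=> /negbT /forall_inPn[u uS /forall_inPn[w wS]].
  rewrite !negb_imply => /and3P[vu vw uw].
  case: (eqVneq u z) => [uz|uz]; last by exists u.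
  by exists w; rewrite // -uz eq_sym uw vw.
have long k : exists x p, [/\ size p = k, uniq (x :: p), path (edge G) x p
                            & all (mem S) (x :: p)].
  elim: k => [|k [x [p [sp up ep Sp]]]]; first by exists x0, [::]; rewrite /= x0S.
  have xS : x \in S by case/andP: Sp.
  (* The default x, used when p is empty, excludes no neighbour of x. *)
  have [y yS [xy yp]] := two x (head x p) xS.
  have yx : y != x.
    by apply: contraTneq xy => ->; rewrite edge_irr.
  have [yin|yout] := boolP (y \in p); last first.
    exists y, (x :: p); split.
    - by rewrite /= sp.
    - by rewrite cons_uniq inE negb_or yx yout.
    - by rewrite /= edge_sym xy.
    - by rewrite /= in Sp *; rewrite yS.
  case/splitPr: yin up ep yp => p1 p2 up ep yp.
  have := hG (x :: rcons p1 y).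
  have cyc : ucycle (edge G) (x :: rcons p1 y).
    move: up ep; rewrite -cat_rcons -cat_cons cat_uniq cat_path.
    move=> /andP[up _] /andP[ep _].
    by rewrite /ucycle up andbT /cycle rcons_path ep last_rcons edge_sym.
  move=> /(_ cyc) {cyc}; rewrite /= size_rcons.
  by case: p1 yp {up ep sp Sp} => //=; rewrite eqxx.
have [x [p [sp up _ _]]] := long #|G|.
by have := max_card (mem (x :: p)); rewrite (card_uniqP up) /= sp ltnn.
Qed.

(** Induction along the removal of leaves.  A vertex without neighbours in S
    counts as a leaf of S, so the components of the forest need not be treated
    one by one. *)
Lemma forest_ind (G : ordered_graph) (P : {set G} -> Prop) :
  acyclic G -> P set0 ->
  (forall (S : {set G}) v, v \in S ->
     (forall u w, u \in S -> w \in S -> edge G v u -> edge G v w -> u = w) ->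
     P (S :\ v) -> P S) ->
  forall S, P S.
Proof.
move=> hG P0 PS S; have [k] := ubnP #|S|; elim: k S => // k IH S ltSk.
have [->//|S0] := eqVneq S set0.
have [v vS hv] := acyclic_leaf hG S0.
apply: (PS _ _ vS hv); apply: IH.
by move: ltSk; rewrite (cardsD1 v S) vS.
Qed.

(** For [D = 2] and the constant weight [d = 1] this is the bound on the number
    of edges of a forest. *)
Lemma forest_weight (G : ordered_graph) (d : G -> G -> nat) (D : nat) :
  acyclic G -> (forall u v, edge G u v -> d u v + d v u <= D) ->
  \sum_u \sum_(v | edge G u v) d u v <= #|G|.-1 * D.
Proof.
move=> hG hD.
suff H (S : {set G}) :
    \sum_(u in S) \sum_(v in S | edge G u v) d u v <= #|S|.-1 * D.
  have := H setT; rewrite cardsT; congr (_ <= _).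
  by apply: eq_big => [u|u _]; [|apply: eq_bigl => v]; rewrite inE.
move: S; apply: (forest_ind hG) => [|S v vS hv IH]; first by rewrite big_set0.
pose T := S :\ v.
have split_sum (f : G -> nat) (Q : pred G) :
    \sum_(w in S | Q w) f w = (if Q v then f v else 0) + \sum_(w in T | Q w) f w.
  rewrite big_mkcondr (big_setD1 v) //=; congr (_ + _).
  by rewrite -big_mkcondr.
(* Each edge at v is counted once from v and once from its other end. *)
have -> : \sum_(u in S) \sum_(w in S | edge G u w) d u w =
    \sum_(u in T | edge G v u) (d v u + d u v)
      + \sum_(u in T) \sum_(w in T | edge G u w) d u w.
  rewrite (big_setD1 v) //= split_sum edge_irr add0n.
  under [X in _ + X = _]eq_bigr => u _ do rewrite split_sum edge_sym.
  by rewrite big_split /= -big_mkcondr /= addnA -big_split.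
have [u /andP[uT vu]|noT] := pickP [pred u in T | edge G v u]; last first.
  rewrite big_pred0 ?add0n; last exact: noT.
  apply: leq_trans IH _; rewrite leq_mul2r; apply/orP; right.
  by rewrite (cardsD1 v S) vS; apply: leq_pred.
have uS : u \in S by move: uT; rewrite inE => /andP[].
rewrite (big_pred1 u); last first.
  move=> w /=; apply/andP/eqP => [[wT vw]|->//].
  by apply: (hv) => //; move: wT; rewrite inE => /andP[].
rewrite (cardsD1 v S) vS /=.
apply: leq_trans (leq_add (hD v u vu) IH) _.
by rewrite (cardsD1 u (S :\ v)) uT /= mulSn.
Qed.

(** * Embedding a forest in a graph *)

(** [d u v] is how much of the room [V u] may be lost on account of the edge
    uv: more than [d u v] points of [V u] cannot all be unrelated to more than
    [d v u] points of [V v].  A leaf v takes its share [d u v] from the set of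
    its only neighbour u and still has, in its own set, more than the [d v u]
    points that this needs. *)
Lemma forest_embedding (G : ordered_graph) (X : finType) (r : rel X)
    (d : G -> G -> nat) (V : G -> {set X}) :
  acyclic G -> symmetric r ->
  (forall u v (A B : {set X}), edge G u v -> A \subset V u -> B \subset V v ->
     d u v < #|A| -> d v u < #|B| -> exists x y, [/\ x \in A, y \in B & r x y]) ->
  (forall u, \sum_(v | edge G u v) d u v < #|V u|) ->
  exists2 g : G -> X,
    forall u, g u \in V u & forall u v, edge G u v -> r (g u) (g v).
Proof.
move=> hG rsym.
(* Vertices outside S keep their sets, so that g is total at every stage. *)
suff H (S : {set G}) : forall V : G -> {set X},
  (forall u v (A B : {set X}), edge G u v -> A \subset V u -> B \subset V v ->
     d u v < #|A| -> d v u < #|B| -> exists x y, [/\ x \in A, y \in B & r x y]) ->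
  (forall u, \sum_(v in S | edge G u v) d u v < #|V u|) ->
  exists2 g : G -> X, forall u, g u \in V u &
    forall u v, u \in S -> v \in S -> edge G u v -> r (g u) (g v).
  move=> hr hV; have [|g gV gr] := H setT V hr.
    by move=> u; under eq_bigl => v do rewrite inE /=; apply: hV.
  by exists g => // u v; apply: gr.
move: S; apply: (forest_ind hG) => [|S v vS hv IH] {}V hr hV.
  have ex u : exists x, x \in V u.
    by apply/set0Pn; rewrite -card_gt0; apply: leq_ltn_trans (hV u).
  by exists (fun u => xchoose (ex u)) => [u|u w]; [apply: xchooseP|rewrite inE].
have sub_sum u : \sum_(w in S :\ v | edge G u w) d u w + (edge G u v) * d u v
                 = \sum_(w in S | edge G u w) d u w.
  rewrite [RHS]big_mkcondr (big_setD1 v) //= -big_mkcondr addnC.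
  by case: (edge G u v); rewrite ?mul1n.
(* Points of the set of a neighbour u of v that have no partner in V v go. *)
pose good x := [exists y in V v, r x y].
pose V' u := if (u \in S) && edge G u v then [set x in V u | good x] else V u.
have subV' u : V' u \subset V u.
  rewrite /V'; case: ifP => // _; apply/subsetP => x.
  by rewrite inE => /andP[].
have [||g gV' gr] := IH V'.
- move=> u w A B uw AV BV; apply: hr => //.
    exact: subset_trans AV (subV' u).
  exact: subset_trans BV (subV' w).
- move=> u; rewrite /V'; case: ifP => [/andP[uS uv]|_]; last first.
    by apply: leq_ltn_trans (hV u); rewrite -sub_sum leq_addr.
  pose bad := [set x in V u | ~~ good x].
  have cardV : #|[set x in V u | good x]| + #|bad| = #|V u|.
    rewrite -(cardsID [set x | good x] (V u)); congr (_ + _).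
      by apply: eq_card => x; rewrite !inE.
    by apply: eq_card => x; rewrite !inE andbC.
  have few_bad : #|bad| <= d u v.
    rewrite leqNgt; apply/negP => many.
    have [|||x [y [xb yV xy]]] := hr u v bad (V v) uv _ _ many.
    - by apply/subsetP => x; rewrite inE => /andP[].
    - exact: subxx.
    - apply: leq_ltn_trans (hV v); rewrite (bigD1 u) ?leq_addr //=.
      by rewrite uS edge_sym.
    - move: xb; rewrite inE => /andP[_ /exists_inP[]].
      by exists y.
  have := hV u; rewrite -sub_sum uv mul1n -cardV.
  lia.
have gV u : g u \in V u by apply: (subsetP (subV' u)).
have [u /andP[uS uv]|nonb] := pickP [pred u in S | edge G u v]; last first.
  exists g => // u w uS wS uw.
  apply: gr => //; rewrite !inE ?uS ?wS andbT; apply/eqP => E.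
    by have /= := nonb w; rewrite wS edge_sym -E uw.
  by have /= := nonb u; rewrite uS -E uw.
have /exists_inP[y yV ry] : good (g u).
  by have := gV' u; rewrite /V' uS uv /= inE => /andP[].
exists (fun w => if w == v then y else g w) => [w|w z wS zS wz].
  by case: eqP => [->|_].
have unb w' : w' \in S -> edge G v w' -> w' = u.
  by move=> w'S vw'; apply: hv; rewrite // edge_sym.
have [Ew|wv] := eqVneq w v; have [Ez|zv] := eqVneq z v.
- by move: wz; rewrite Ew Ez edge_irr.
- by rewrite (unb z) // -?Ew // rsym.
- by rewrite (unb w) // edge_sym -Ez.
- by apply: gr; rewrite // !inE ?wv ?zv ?wS ?zS.
Qed.

(** * Ordered copies *)

Lemma contains_copyI (G' G : ordered_graph) (f : G -> G') :
  {homo f : x y / (x < y)%O} ->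
  (forall x y, edge G x y -> edge G' (f x) (f y)) ->
  contains_copy G' G.
Proof.
move=> flt fe; have fle := le_mono flt.
have finj : injective f by apply: inc_inj.
pose D x' y' := [exists x, exists y, [&& x' == f x, y' == f y & edge G x y]].
have DP x' y' : reflect (exists x y, [/\ x' = f x, y' = f y & edge G x y])
                        (D x' y').
  apply: (iffP existsP) => [[x /existsP[y /and3P[/eqP-> /eqP-> xy]]]|].
    by exists x, y.
  by move=> [x [y [-> -> xy]]]; exists x; apply/existsP; exists y; rewrite !eqxx.
exists (f @: [set: G]), D, f; split; split=> //.
- by move=> x' y'; apply/DP/DP => -[x [y [-> -> xy]]]; exists y, x;
    rewrite edge_sym.
- move=> x' y' /DP[x [y [-> -> xy]]].
  by rewrite !imset_f ?inE //; split=> //; apply: fe.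
- move=> x y; apply/DP/idP => [[u [v [/finj-> /finj-> //]]]|xy].
  by exists x, y.
Qed.

(** The first a points of A followed by the first b points of B carry the
    copy. *)
Lemma contains_Kab N a b (G' : rel 'I_N) (Gs : symmetric G')
    (Gi : irreflexive G') (A B : {set 'I_N}) :
  0 < a -> a <= #|A| -> b <= #|B| ->
  (forall x y, x \in A -> y \in B -> x < y) ->
  (forall x y, x \in A -> y \in B -> G' x y) ->
  contains_copy (OrderedGraph Gs Gi) (Kab a b).
Proof.
move=> a0 leA leB ltAB eAB.
have sorted_enum (C : {set 'I_N}) : sorted ltn (map val (enum C)).
  rewrite /enum_mem -enumT sorted_map; apply: sorted_filter.
    by move=> y x z; apply: ltn_trans.
  by rewrite -sorted_map val_enum_ord iota_ltn_sorted.
pose sA := take a (enum A); pose sB := take b (enum B).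
have szA : size sA = a by rewrite size_takel -?cardE.
have szB : size sB = b by rewrite size_takel -?cardE.
have inA i : i \in sA -> i \in A by move=> /mem_take; rewrite mem_enum.
have inB i : i \in sB -> i \in B by move=> /mem_take; rewrite mem_enum.
have ss : sorted ltn (map val (sA ++ sB)).
  rewrite sorted_pairwise ?map_cat ?pairwise_cat; last exact: ltn_trans.
  rewrite -!sorted_pairwise ?map_take; try exact: ltn_trans.
  rewrite !take_sorted ?sorted_enum // !andbT -!map_take.
  by apply/allrelP => _ _ /mapP[x /inA xA ->] /mapP[y /inB yB ->]; apply: ltAB.
have /set0Pn[x0 _] : A != set0 by rewrite -card_gt0 (leq_trans a0 leA).
pose f (i : Kab a b) : OrderedGraph Gs Gi := nth x0 (sA ++ sB) i.
have sz : size (sA ++ sB) = a + b by rewrite size_cat szA szB.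
have fA (i : 'I_(a + b)) : i < a -> f i \in A.
  by move=> ia; apply: inA; rewrite /f nth_cat szA ia mem_nth ?szA.
have fB (i : 'I_(a + b)) : ~~ (i < a) -> f i \in B.
  move=> ia; apply: inB; rewrite /f nth_cat szA (negPf ia) mem_nth ?szB //.
  by rewrite ltn_subLR ?ltn_ord // leqNgt.
apply: (@contains_copyI _ _ f) => [i j|i j].
  rewrite !ltEord => ij.
  have := sorted_ltn_nth ltn_trans 0 ss; move=> /(_ i j).
  by rewrite !inE size_map sz !ltn_ord !(nth_map x0) ?sz //; apply.
rewrite /= /Kab_edge; case: ltnP => ia; case: ltnP => // ja _.
  by apply: eAB; [apply: fA|apply: fB; rewrite -leqNgt].
by rewrite Gs; apply: eAB; [apply: fA|apply: fB; rewrite -leqNgt].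
Qed.

(** * Consecutive intervals *)

Lemma consecutive_intervals disp (T : finOrderType disp) (k : T -> nat) N :
  \sum_u k u <= N ->
  exists2 V : T -> {set 'I_N}, forall u, #|V u| = k u &
    forall u v x y, (u < v)%O -> x \in V u -> y \in V v -> x < y.
Proof.
move=> leN; pose off u := \sum_(w | (w < u)%O) k w.
have off_next u : off u + k u = \sum_(w | (w <= u)%O) k w.
  rewrite [RHS](bigD1 u) //= addnC; congr (_ + _).
  by apply: eq_bigl => w; rewrite lt_neqAle andbC.
have sub_sum (P Q : pred T) : (forall w, P w -> Q w) ->
    \sum_(w | P w) k w <= \sum_(w | Q w) k w.
  move=> PQ; rewrite [leqLHS]big_mkcond [leqRHS]big_mkcond leq_sum // => w _.
  by have := PQ w; case: (P w) => // ->.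
exists (fun u => [set i : 'I_N | off u <= i < off u + k u]) => [u|u v x y uv].
  have offN : off u + k u <= N.
    by rewrite off_next; apply: leq_trans leN; apply: sub_sum.
  rewrite -sum1dep_card -(big_mkord (fun i => off u <= i < off u + k u) (fun=> 1)).
  rewrite -big_nat_widen //.
  have <- := big_nat_widenl (off u) 0 (off u + k u) predT (fun=> 1) (leq0n _).
  by rewrite sum_nat_const_nat muln1 addKn.
rewrite !inE => /andP[_ xu] /andP[vy _].
apply: leq_trans xu (leq_trans _ vy); rewrite off_next.
by apply: sub_sum => w wu; apply: le_lt_trans uv.
Qed.

(** * The least number *)

(** Nothing decides P, so the search for a smaller element is by excluded
    middle. *)
Lemma least_nat (P : nat -> Prop) N : P N ->
  exists R, (P R /\ forall M, P M -> R <= M) /\ R <= N.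
Proof.
elim/ltn_ind: N => N IH PN.
have [[M PM ltMN]|least] := classic (exists2 M, P M & M < N).
  have [R [leastR leRM]] := IH M ltMN PM.
  by exists R; split=> //; apply: leq_trans leRM (ltnW ltMN).
exists N; split=> //; split=> // M PM; rewrite leqNgt; apply/negP => ltMN.
by apply: least; exists M.
Qed.

Theorem theorem1p3 (F : ordered_graph) (n a b : nat)
    (hF : acyclic F) (hn : #|F| = n) (hn0 : 0 < n) (ha : 1 <= a) (hb : 1 <= b) :
  exists R : nat,
    is_ordered_ramsey_number F (Kab a b) R /\
    R <= 1 + (n - 1) * (a + b - 1).
Proof.
apply: least_nat => c; set N := 1 + _ in c *.
case: (classic (contains_copy (colour_class c false) (Kab a b))) => [|noblue].
  by right.
left; pose d (u v : F) := if (u < v)%O then a.-1 else b.-1.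
have [|V cardV ltV] := @consecutive_intervals _ F
    (fun u => 1 + \sum_(v | edge F u v) d u v) N.
  rewrite big_split /= sum1_card hn.
  have dsum : \sum_u \sum_(v | edge F u v) d u v <= n.-1 * (a.-1 + b.-1).
    rewrite -hn; apply: forest_weight => //.
    move=> u v uv; rewrite /d; case: (ltgtP u v) => [//|_|E].
      by rewrite addnC.
    by move: uv; rewrite E edge_irr.
  apply: leq_trans (leq_add (leqnn n) dsum) _.
  have -> : N = 1 + n.-1 * (a.-1 + b.-1).+1.
    by rewrite /N subn1; congr (1 + _ * _); lia.
  by rewrite mulnS addnA add1n prednK.
have [|||g gV gr] := @forest_embedding F _ (colour_edge c true) d V hF.
- exact: colour_edge_sym.
- have red u v (A B : {set 'I_N}) : (u < v)%O -> A \subset V u ->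
      B \subset V v -> a <= #|A| -> b <= #|B| ->
      exists x y, [/\ x \in A, y \in B & colour_edge c true x y].
    move=> uv /subsetP AV /subsetP BV leA leB.
    have lt x y : x \in A -> y \in B -> x < y.
      by move=> xA yB; apply: ltV uv (AV _ xA) (BV _ yB).
    apply: NNPP => nored; apply: noblue.
    apply: (contains_Kab _ _ ha leA leB lt) => x y xA yB.
    have xy : x != y by have := lt x y xA yB; rewrite ltn_neqAle => /andP[].
    rewrite /colour_edge xy /= eqbF_neg; apply/negP => cxy.
    by apply: nored; exists x, y; rewrite /colour_edge xy cxy.
  move=> u v A B uv AV BV; rewrite /d.
  case: (ltgtP u v) => [uv'|vu|E]; last by move: uv; rewrite E edge_irr.
    by rewrite !prednK //; apply: red AV BV.
  rewrite !prednK // => leA leB.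
  have [x [y [xB yA xy]]] := red v u B A vu BV AV leB leA.
  by exists y, x; rewrite colour_edge_sym.
- by move=> u; rewrite cardV.
apply: (@contains_copyI _ _ (g : F -> colour_class c true)) => // u v uv.
by rewrite ltEord; apply: ltV uv (gV u) (gV v).
Qed.
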